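(* Let $p,q>1$ be integers, and consider $Q_{pq}^{F}$ where either I. $F\subseteq (F_{pq})^{\ast}$ with $F\neq\emptyset$; or II. $F=(E_{pq}\setminus F')^{\ast}$ with $F'\subseteq F_{pq}$ and $F'\neq\emptyset$. Then $\Delta_r(B(Q_{pq}^{F}))=1$, where $r=\operatorname{rank}(B(Q_{pq}^{F}))$.
   Context: Let $P=\{p_1,\dots,p_p\}$, $P^{\ast}=\{p_1^{\ast},\dots,p_p^{\ast}\}$, $Q=\{q_1,\dots,q_q\}$, $Q^{\ast}=\{q_1^{\ast},\dots,q_q^{\ast}\}$ and two further elements $\mathbf{r},\mathbf{r}^{\ast}$ be pairwise distinct, and let $V_{pq}=P\cup P^{\ast}\cup Q\cup Q^{\ast}\cup\{\mathbf{r},\mathbf{r}^{\ast}\}$ (the vertices $\mathbf r,\mathbf r^\ast$ are unrelated to the rank $r$). The map $v\mapsto v^{\ast}$ is the involution exchanging $p_i\leftrightarrow p_i^{\ast}$, $q_i\leftrightarrow q_i^{\ast}$, $\mathbf{r}\leftrightarrow \mathbf{r}^{\ast}$; for $S\subseteq V_{pq}$, $S^{\ast}=\{v^{\ast}:v\in S\}$, and for a family $F$ of subsets, $F^{\ast}=\{f^{\ast}:f\in F\}$. Juxtaposition denotes union, e.g. $XYz=X\cup Y\cup\{z\}$. The hypergraph $Q_{pq}=(V_{pq},E_{pq})$ has as edges exactly the sets $P_1(P\setminus P_1)^{\ast}Q\mathbf{r}$ and $(P\setminus P_1)P_1^{\ast}Q^{\ast}\mathbf{r}$ for $\emptyset\ne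 P_1\subseteq P$, and $P(Q\setminus Q_1)Q_1^{\ast}\mathbf{r}^{\ast}$ and $P^{\ast}Q_1(Q\setminus Q_1)^{\ast}\mathbf{r}^{\ast}$ for $\emptyset\neq Q_1\subseteq Q$. Put $F_{pq}=\{PQ\mathbf{r},\ P^{\ast}Q^{\ast}\mathbf{r},\ PQ^{\ast}\mathbf{r}^{\ast},\ P^{\ast}Q\mathbf{r}^{\ast}\}\subseteq E_{pq}$, and for $F\subseteq E_{pq}^{\ast}$ let $Q_{pq}^{F}=(V_{pq},E_{pq}\cup F)$. If $v_1,\dots,v_k$ are the characteristic vectors (as columns) of the edges of $Q_{pq}^F$, then $B(Q_{pq}^{F})=\begin{pmatrix} v_1&\cdots&v_k\\ 1&\cdots&1\end{pmatrix}$. For a nonzero integral matrix $B$, $\Delta_r(B)$ is the greatest common divisor of all the nonzero $r\times r$ subdeterminants of $B$. *)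

(* Defs.v *)
From mathcomp Require Import all_boot all_order all_algebra.

Set Implicit Arguments.
Unset Strict Implicit.
Unset Printing Implicit Defensive.

Import GRing.Theory.
Local Open Scope ring_scope.

(* A vertex is a pair (x, b), where x names p_i, q_j or the distinguished
   vertex r, and b tells whether the vertex is starred. *)
Definition vertex (p q : nat) : finType := (('I_p + 'I_q + unit) * bool)%type.

Section Hypergraph.

Variables p q : nat.
Implicit Types (v : vertex p q) (S : {set vertex p q}).
Implicit Types F : {set {set vertex p q}}.

Definition pv (i : 'I_p) : vertex p q := (inl (inl i), false).
Definition qv (j : 'I_q) : vertex p q := (inl (inr j), false).
Definition rv : vertex p q := (inr tt, false).

Definition star v : vertex p q := (v.1, ~~ v.2).
Definition starS S : {set vertex p q} := [set star v | v in S].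
Definition starF F : {set {set vertex p q}} := [set starS S | S in F].

Definition Pset : {set vertex p q} := [set pv i | i : 'I_p].
Definition Qset : {set vertex p q} := [set qv j | j : 'I_q].

Definition Epq : {set {set vertex p q}} :=
     [set P1 :|: starS (Pset :\: P1) :|: Qset :|: [set rv]
       | P1 in powerset Pset & P1 != set0]
 :|: [set (Pset :\: P1) :|: starS P1 :|: starS Qset :|: [set rv]
       | P1 in powerset Pset & P1 != set0]
 :|: [set Pset :|: (Qset :\: Q1) :|: starS Q1 :|: [set star rv]
       | Q1 in powerset Qset & Q1 != set0]
 :|: [set starS Pset :|: Q1 :|: starS (Qset :\: Q1) :|: [set star rv]
       | Q1 in powerset Qset & Q1 != set0].

Definition Fpq : {set {set vertex p q}} :=
  [set Pset :|: Qset :|: [set rv];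
       starS Pset :|: starS Qset :|: [set rv];
       Pset :|: starS Qset :|: [set star rv];
       starS Pset :|: Qset :|: [set star rv]].

(* The vertex set is the whole type, so Q_pq^F is given by its edge set. *)
Definition Qpq F : {set {set vertex p q}} := Epq :|: F.

End Hypergraph.

(* Rows and columns are listed in the order of the enumerations of V and E;
   this order affects neither the rank nor Delta. *)
Definition Bmx (V : finType) (E : {set {set V}}) : 'M[int]_(#|V| + 1, #|E|) :=
  col_mx (\matrix_(i < #|V|, j < #|E|) (enum_val i \in enum_val j)%:R)
         (const_mx 1).

Definition rankZ (m n : nat) (B : 'M[int]_(m, n)) : nat :=
  \rank (map_mx (intr : int -> rat) B).

Definition increasing (r n : nat) (f : {ffun 'I_r -> 'I_n}) : bool :=
  [forall i : 'I_r, forall j : 'I_r, (i < j)%N ==> (f i < f j)%N].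

(* An r x r submatrix keeps r rows and r columns, given by strictly increasing
   maps; with no nonzero subdeterminant, the gcd is 0. *)
Definition Delta (r m n : nat) (B : 'M[int]_(m, n)) : nat :=
  \big[gcdn/0%N]_(fg : {ffun 'I_r -> 'I_m} * {ffun 'I_r -> 'I_n}
      | [&& increasing fg.1, increasing fg.2 & \det (mxsub fg.1 fg.2 B) != 0])
    `|\det (mxsub fg.1 fg.2 B)|%N.

(* Main.v *)
(** Every edge, starred or not, contains exactly one vertex of each pair
    [{v, v*}], so the rows of [v] and [v*] add up to the all-ones row and the
    row space is spanned by the p + q + 2 rows of P*, r, Q*, r*. Restricted to
    these rows, the edges [(P \ p_i) p_i* Q r], [P Q r], [P* (Q \ q_j) q_j* r*]
    and [P* Q r*] of Q_pq, which are edges because p, q > 1, form a block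
    triangular matrix with unitriangular diagonal blocks. So the rank is
    p + q + 2 and a maximal minor equals 1, whatever F is. *)

Require Import Defs.
From mathcomp Require Import all_boot all_order all_algebra all_fingroup.

Set Implicit Arguments.
Unset Strict Implicit.
Unset Printing Implicit Defensive.

Import GRing.Theory.
Local Open Scope ring_scope.

(** Let [rk i] count the indices with a smaller value of [f]. For injective [f] it grows strictly
    with [f i], hence is a permutation, and its inverse lists the indices by increasing value. *)
Lemma increasing_perm r n (f : 'I_r -> 'I_n) :
  injective f -> exists s : 'S_r, increasing [ffun i => f (s i)].
Proof.
move=> f_inj; pose below i := [set k | (f k < f i)%N].
have below_lt i : (#|below i| < r)%N.
  rewrite -[X in (_ < X)%N]card_ord -cardsT; apply: proper_card.
  by rewrite properT; apply/eqP => /setP/(_ i); rewrite !inE ltnn.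
pose rk i := Ordinal (below_lt i).
have rk_lt i j : (f i < f j)%N -> (rk i < rk j)%N.
  move=> lt_ij; apply: proper_card; apply/properP; split.
    by apply/subsetP => k; rewrite !inE => /ltn_trans; apply.
  by exists i; rewrite inE ?ltnn.
have rk_inj : injective rk.
  move=> i j eq_rk; apply: f_inj; apply: val_inj.
  by case: (ltngtP (f i) (f j)) => // /rk_lt; rewrite eq_rk ltnn.
exists (perm rk_inj)^-1%g; apply/'forall_forallP => i j; apply/implyP=> lt_ij.
have rkK k : rk ((perm rk_inj)^-1%g k) = k by rewrite -(permE rk_inj) permKV.
rewrite !ffunE; case: ltngtP => //.
  by move=> /rk_lt; rewrite !rkK ltnNge (ltnW lt_ij).
by move=> /val_inj/f_inj/perm_inj eq_ij; rewrite eq_ij ltnn in lt_ij.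
Qed.

Lemma det_mxsub_inj (R : comNzRingType) r m n (B : 'M[R]_(m, n)) f g :
  \det (mxsub f g B) != 0 :> R -> injective (f : 'I_r -> 'I_m).
Proof.
move=> nz i j eq_f; apply/eqP; apply: contraNT nz => ne_ij; apply/eqP.
by apply: (determinant_alternate ne_ij) => k; rewrite !mxE eq_f.
Qed.

(** Sorting [f] and [g] permutes rows and columns, which changes the determinant at most by a sign.
    The sorted pair is an admissible term equal to 1, and the gcd divides it. *)
Lemma Delta_unimodular r m n (B : 'M[int]_(m, n)) f g :
  `|\det (mxsub (f : 'I_r -> 'I_m) g B)|%N = 1%N -> Delta r B = 1%N.
Proof.
move=> det1; have nz : \det (mxsub f g B) != 0 by rewrite -absz_eq0 det1.
have f_inj := det_mxsub_inj nz.
have g_inj : injective g.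
  apply: (@det_mxsub_inj _ _ _ _ B^T g f); rewrite -det_tr.
  suff -> : (mxsub g f B^T)^T = mxsub f g B by [].
  by apply/matrixP=> i j; rewrite !mxE.
have [s inc_s] := increasing_perm f_inj.
have [t inc_t] := increasing_perm g_inj.
set fs := finfun _ in inc_s; set gt := finfun _ in inc_t.
have subE : mxsub fs gt B = row_perm s (col_perm t (mxsub f g B)).
  by apply/matrixP=> i j; rewrite !mxE !ffunE.
have det_st1 : `|\det (mxsub fs gt B)|%N = 1%N.
  rewrite subE row_permE col_permE !det_mulmx !det_perm !abszM det1.
  by rewrite !abszX !exp1n.
apply/eqP; rewrite -dvdn1 -[in X in (_ %| X)%N]det_st1.
apply: (@biggcdn_inf _ (fs, gt)) => //=.
by rewrite inc_s inc_t -absz_eq0 det_st1.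
Qed.

(** The r chosen rows span the row space, so the rank is at most r; the minor is invertible over
    [rat], so the rank is at least r. *)
Lemma rankZ_unimodular r m n (B : 'M[int]_(m, n)) f g :
    `|\det (mxsub (f : 'I_r -> 'I_m) g B)|%N = 1%N ->
    (map_mx intr B <= rowsub f (map_mx (intr : int -> rat) B))%MS ->
  rankZ B = r.
Proof.
move=> det1 subB; apply/eqP; rewrite eqn_leq; apply/andP; split.
  exact: leq_trans (mxrankS subB) (rank_leq_row _).
have <- : \rank (mxsub f g (map_mx (intr : int -> rat) B)) = r.
  apply: mxrank_unit; rewrite -map_mxsub unitmxE det_map_mx unitfE intr_eq0.
  by rewrite -absz_eq0 det1.
(* Selecting columns is right multiplication by columns of the identity, so it cannot increase the
   rank. *)
have -> : mxsub f g (map_mx intr B)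
    = rowsub f (map_mx intr B) *m colsub g (1%:M : 'M[rat]_n).
  by rewrite mulmx_colsub mulmx1; apply/matrixP=> i j; rewrite !mxE.
exact: leq_trans (mxrankM_maxl _ _) (mxrankS (rowsub_sub _ _)).
Qed.

Section Transversals.

Variables p q : nat.
Implicit Types (v : vertex p q) (S : {set vertex p q}).

Lemma starK : involutive (@star p q).
Proof. by case=> x b; rewrite /star /= negbK. Qed.

Lemma in_starS S v : (v \in starS S) = (star v \in S).
Proof. by rewrite -{1}(starK v) mem_imset //; apply: inv_inj starK. Qed.

Lemma in_Pset v :
  (v \in Pset p q) = if v.1 is inl (inl _) then ~~ v.2 else false.
Proof.
apply/imsetP/idP => [[i _ ->] //|].
by case: v => [[[i|]|]] [] //= _; exists i.
Qed.

Lemma in_Qset v :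
  (v \in Qset p q) = if v.1 is inl (inr _) then ~~ v.2 else false.
Proof.
apply/imsetP/idP => [[i _ ->] //|].
by case: v => [[[|j]|]] [] //= _; exists j.
Qed.

Definition transversal S := forall v, (star v \in S) = (v \notin S).

Lemma transversal_starS S : transversal S -> transversal (starS S).
Proof. by move=> trS v; rewrite !in_starS !trS. Qed.

Lemma transversal_Epq S : S \in Epq p q -> transversal S.
Proof.
(* Only the membership of v and v* in [A] is unknown. As [A] lies in P or Q, it contains no starred
   vertex, so [subA] is applied to both. *)
rewrite 3!inE => /orP[/orP[/orP[]|]|] /imsetP[A];
  rewrite !inE => /andP[/subsetP subA _] -> v;
  have := subA v; have := subA (star v);
  rewrite !(inE, in_starS, in_Pset, in_Qset) starK.
all: case: v => [[[i|j]|[]] []] /=.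
all: do 2?case: (_ \in A) => //=; try by move=> _ /(_ isT).
all: try by move=> /(_ isT).
Qed.

Lemma transversal_Fpq S : S \in Fpq p q -> transversal S.
Proof.
rewrite !inE => /orP[/orP[/orP[]|]|] /eqP-> v;
  rewrite !(inE, in_starS, in_Pset, in_Qset).
all: by case: v => [[[i|j]|[]] []].
Qed.

Lemma split_lshift m n (i : 'I_m) : split (lshift n i) = inl i.
Proof. exact: unsplitK (inl i). Qed.

Lemma split_rshift m n (i : 'I_n) : split (rshift m i) = inr i.
Proof. exact: unsplitK (inr i). Qed.

(** One vertex of each pair {v, v*}, plus the partner of r. The order P*, r, Q*, r* parallels that
    of [core_edge]. *)
Definition core_vertex (k : 'I_((p + 1) + (q + 1))) : vertex p q :=
  match split k with
  | inl k' => if split k' is inl i then star (pv q i) else rv p q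
  | inr k' => if split k' is inl j then star (qv p j) else star (rv p q)
  end.

Lemma core_vertex_cover v :
  exists k, core_vertex k = v \/ core_vertex k = star v.
Proof.
pose splitE := (split_lshift, split_rshift); rewrite /core_vertex.
case: v => [[[i|j]|[]] b].
- exists (lshift _ (lshift _ i)); rewrite !splitE.
  by case: b; [left | right].
- exists (rshift _ (lshift _ j)); rewrite !splitE.
  by case: b; [left | right].
- exists (lshift _ (rshift _ ord0)); rewrite !splitE.
  by case: b; [right | left].
Qed.

(** For P1 = P \ p_i the only starred P-vertex of the edge is p_i*, and for P1 = P there is none: an
    identity block followed by a zero column. Q1 acts likewise on Q*. *)
Definition core_edge (k : 'I_((p + 1) + (q + 1))) : {set vertex p q} :=
  let PQr P1 := P1 :|: starS (Pset p q :\: P1) :|: Qset p q :|: [set rv p q] in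
  let PQs Q1 :=
    starS (Pset p q) :|: Q1 :|: starS (Qset p q :\: Q1) :|: [set star (rv p q)]
  in
  match split k with
  | inl k' => PQr (if split k' is inl i then Pset p q :\ pv q i else Pset p q)
  | inr k' => PQs (if split k' is inl j then Qset p q :\ qv p j else Qset p q)
  end.

Lemma core_edge_Epq k : (1 < p)%N -> (1 < q)%N -> core_edge k \in Epq p q.
Proof.
(* A second index keeps P \ p_i and Q \ q_j nonempty, as [Epq] demands. *)
move=> p_gt1 q_gt1; have neq n (i : 'I_n) : (1 < n)%N -> exists j, j != i.
  move=> n_gt1; have: (0 < #|predC1 i|)%N.
    by rewrite cardC1 card_ord -subn1 subn_gt0.
  by case/card_gt0P=> j; exists j.
rewrite /core_edge !in_setU; case: split => k'.
  apply/orP; left; apply/orP; left; apply/orP; left; apply: imset_f.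
  have [P0 _] := neq _ (Ordinal p_gt1) p_gt1.
  case: split => [i|_]; rewrite inE powersetE ?subsetDl ?subxx; apply/set0Pn.
    have [j ne_ji] := neq _ i p_gt1; exists (pv q j).
    by rewrite !inE in_Pset /= andbT; apply: contra ne_ji => /eqP[->].
  by exists (pv q P0); rewrite in_Pset.
apply/orP; right; apply: imset_f.
have [Q0 _] := neq _ (Ordinal q_gt1) q_gt1.
case: split => [i|_]; rewrite inE powersetE ?subsetDl ?subxx; apply/set0Pn.
  have [j ne_ji] := neq _ i q_gt1; exists (qv p j).
  by rewrite !inE in_Qset /= andbT; apply: contra ne_ji => /eqP[->].
by exists (qv p Q0); rewrite in_Qset.
Qed.

Definition core_mx : 'M[int]_((p + 1) + (q + 1)) :=
  \matrix_(i, j) (core_vertex i \in core_edge j)%:R.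

Lemma det_core_mx : \det core_mx = 1.
Proof.
(* The last row of [T n] is all ones because r, respectively r*, lies in every edge of its block. *)
pose T n : 'M[int]_(n + 1) := block_mx 1%:M 0 (const_mx 1) 1%:M.
have detT n : \det (T n) = 1 by rewrite det_lblock !det1 mulr1.
(* The edges of the first block avoid Q* and r*, whence the zero block. *)
suff -> : core_mx = block_mx (T p) (ursubmx core_mx) 0 (T q).
  by rewrite det_ublock !detT mulr1.
rewrite -[LHS]submxK; congr block_mx; apply/matrixP=> i j;
  rewrite -[i]splitK -[j]splitK;
  case: (split i) => {}i; case: (split j) => {}j /=;
  rewrite ?(block_mxEul, block_mxEur, block_mxEdl, block_mxEdr) !mxE;
  rewrite /core_vertex /core_edge !(split_lshift, split_rshift);
  rewrite !(inE, in_starS, in_Pset, in_Qset) ?starK /= //.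
- by rewrite !xpair_eqE /= !andbT !orbF negbK !andbF.
- by rewrite !ord1.
- by rewrite !xpair_eqE /= !andbT !orbF negbK !andbF.
- by rewrite !ord1.
Qed.

(** Both r and r* are core vertices, so their rows sum to the all-ones row inside the span.
    Subtracting a core row from it gives the row of the partner vertex. *)
Lemma Bmx_core_rows (E : {set {set vertex p q}}) :
    {in E, forall S, transversal S} ->
  (map_mx intr (Bmx E) <= rowsub (fun k => lshift 1 (enum_rank (core_vertex k)))
                            (map_mx (intr : int -> rat) (Bmx E)))%MS.
Proof.
move=> trE; pose f k := lshift 1 (enum_rank (core_vertex k)).
set B := map_mx _ _; rewrite -/f.
have sub_core k : (row (f k) B <= rowsub f B)%MS.
  by have := row_sub k (rowsub f B); rewrite row_rowsub.
have rowD v : row (lshift 1 (enum_rank v)) B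
    + row (lshift 1 (enum_rank (star v))) B = row (rshift _ ord0) B.
  apply/rowP=> j; rewrite /B /Bmx map_col_mx !(rowKu, rowKd) !mxE !enum_rankK.
  by rewrite trE ?enum_valP //; case: (v \in _).
have sub1 : (row (rshift _ ord0) B <= rowsub f B)%MS.
  rewrite -(rowD (rv p q)) addmx_sub //.
    have := sub_core (lshift _ (rshift _ ord0)).
    by rewrite /f /core_vertex split_lshift split_rshift.
  have := sub_core (rshift _ (rshift _ ord0)).
  by rewrite /f /core_vertex !split_rshift.
apply/row_subP=> i; rewrite -[i]splitK; case: (split i) => {}i /=; last first.
  by rewrite ord1.
rewrite -[i]enum_valK; have [k [<-|Ek]] := core_vertex_cover (enum_val i).
  exact: sub_core.
rewrite -[row _ B](addrK (row (f k) B)) {1}/f Ek rowD.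
by rewrite addmx_sub ?eqmx_opp.
Qed.

End Transversals.

Theorem proposition4p3 (p q : nat) (hp : (1 < p)%N) (hq : (1 < q)%N)
    (F : {set {set vertex p q}})
    (hF : (F \subset starF (Fpq p q) /\ F <> set0)
          \/ (exists F' : {set {set vertex p q}},
                [/\ F' \subset Fpq p q, F' <> set0
                  & F = starF (Epq p q :\: F')])) :
  Delta (rankZ (Bmx (Qpq F))) (Bmx (Qpq F)) = 1%N.
Proof.
(* In both cases F consists of stars of sets in [Epq] or [Fpq], and starring preserves
   transversality. *)
have trE : {in Qpq F, forall S, transversal S}.
  move=> S; rewrite inE => /orP[/transversal_Epq //|].
  case: hF => [[/subsetP subF _] /subF|[F' [_ _ ->]]] /imsetP[S' S'in ->].
    by apply/transversal_starS/transversal_Fpq.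
  by move: S'in; rewrite inE => /andP[_ S'E]; apply/transversal_starS/transversal_Epq.
have core_in k : core_edge k \in Qpq F by rewrite inE core_edge_Epq.
pose f k := lshift 1 (enum_rank (@core_vertex p q k)).
pose g k := enum_rank_in (core_in k) (core_edge k).
have det1 : `|\det (mxsub f g (Bmx (Qpq F)))|%N = 1%N.
  (* As [f] only takes left-shifted values, the appended row of ones is never selected and all
     entries are incidences. *)
  suff -> : mxsub f g (Bmx (Qpq F)) = core_mx p q by rewrite det_core_mx.
  by apply/matrixP=> i j; rewrite !mxE split_lshift !mxE enum_rankK enum_rankK_in.
by rewrite (rankZ_unimodular det1 (Bmx_core_rows trE)) (Delta_unimodular det1).
Qed.
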